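(* (Doob's Convergence Theorem) Fix an imprecise probability tree $(\overline{\mathrm Q}_s)_{s\in\mathscr X^\ast}$ and let $\mathscr M\in\overline{\mathbb M}_{\mathrm b}$ be any supermartingale. If $\mathscr M(s)$ is real for some situation $s\in\mathscr X^\ast$, then $\mathscr M$ converges to a real number strictly almost surely within $\Gamma(s)$; that is, the event $\{\omega\in\Gamma(s)\colon \lim_{n\to+\infty}\mathscr M(\omega^n)\text{ exists and is real}\}$ is strictly almost sure within $\Gamma(s)$.
   Context: $\overline{\mathbb R}=\mathbb R\cup\{+\infty,-\infty\}$, $\mathbb N=\{1,2,\dots\}$, $\mathbb N_0=\mathbb N\cup\{0\}$. Conventions: $+\infty-\infty=-\infty+\infty=+\infty$, $0\cdot(\pm\infty)=0$, otherwise the usual arithmetic on $\overline{\mathbb R}$. For a non-empty set $\mathscr Y$, $\overline{\mathscr L}_b(\mathscr Y)$ is the set of all maps $f\colon\mathscr Y\to\overline{\mathbb R}$ that are bounded below (there is $M\in\mathbb R$ with $f\ge M$). An upper expectation on $\overline{\mathscr L}_b(\mathscr Y)$ is a map $\overline{\mathrm E}\colon\overline{\mathscr L}_b(\mathscr Y)\to\overline{\mathbb R}$ such that: (E1) $\overline{\mathrm E}(c)=c$ for all constants $c\in\mathbb R$; (E2) $\overline{\mathrm E}(f+g)\le\overline{\mathrm E}(f)+\overline{\mathrm E}(g)$ for all $f,g$; (E3) $\overline{\mathrm E}(\lambda f)=\lambda\overline{\mathrm E}(f)$ for all $\lambda\in(0,+\infty)\cup\{+\infty\}$ and all non-negative $f$;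 (E4) $f\le g$ implies $\overline{\mathrm E}(f)\le\overline{\mathrm E}(g)$. $\mathscr X$ is a fixed non-empty finite set (state space). A situation is a finite string $x_{1:n}=(x_1,\dots,x_n)\in\mathscr X^n$, $n\in\mathbb N_0$ (the empty string is denoted $\Box$); $\mathscr X^\ast$ is the set of all situations; $sx$ is the string $s$ followed by $x\in\mathscr X$. $\Omega=\mathscr X^{\mathbb N}$ is the set of paths; for $\omega\in\Omega$, $\omega^n$ is the string of its first $n$ entries. $\Gamma(s)$ is the set of all paths that start with the string $s$. An imprecise probability tree assigns to every $s\in\mathscr X^\ast$ an upper expectation $\overline{\mathrm Q}_s$ on $\overline{\mathscr L}_b(\mathscr X)$. A supermartingale (for the given tree) is a map $\mathscr M\colon\mathscr X^\ast\to\overline{\mathbb R}$ that is bounded below by a real constant and satisfies $\overline{\mathrm Q}_s(\mathscr M(s\,\cdot))\le\mathscr M(s)$ for all $s\in\mathscr X^\ast$, where $\mathscr M(s\,\cdot)(x)=\mathscr M(sx)$. $\overline{\mathbb M}_{\mathrm b}$ is the set of all supermartingales. An $s$-test supermartingale is a non-negative supermartingale $\mathscr M$ with $\mathscr M(s)=1$. An event $A\subseteq\Gamma(s)$ is strictly almost sure (s.a.s.) within $\Gamma(s)$ if there is an $s$-test supermartingale $\mathscr T$ with $\lim_{n\to+\infty}\mathscr T(\omega^n)=+\infty$ for all $\omega\in\Gamma(s)\setminus A$. *)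

(* Defs.v *)
From mathcomp Require Import all_boot all_order all_algebra.
From mathcomp Require Import all_classical all_reals all_analysis.

Set Implicit Arguments.
Unset Strict Implicit.
Unset Printing Implicit Defensive.

Import Order.TTheory GRing.Theory Num.Theory.
Import numFieldNormedType.Exports.

Local Open Scope classical_set_scope.
Local Open Scope ring_scope.
Local Open Scope ereal_scope.

Definition bounded_below (R : realType) (Y : Type) (f : Y -> \bar R) : Prop :=
  exists m : R, forall y, m%:E <= f y.

(* An upper expectation lives on the bounded-below maps only; it is encoded as
   a total functional about which nothing is required off that domain.
   Addition is the dual one of [%dE], for which +oo + -oo = +oo, whereas the
   default addition on \bar R gives -oo.  Multiplication has 0 * +oo = 0. *)
Record upper_expectation (R : realType) (Y : Type)
    (E : (Y -> \bar R) -> \bar R) : Prop := UpperExpectation {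
  upper_cst : forall c : R, E (fun=> c%:E) = c%:E ;
  upper_subadd : forall f g : Y -> \bar R,
    bounded_below f -> bounded_below g ->
    E (fun y => (f y + g y)%dE) <= (E f + E g)%dE ;
  upper_homo : forall (l : \bar R) (f : Y -> \bar R),
    0 < l -> (forall y, 0 <= f y) -> E (fun y => l * f y) = l * E f ;
  upper_le : forall f g : Y -> \bar R,
    bounded_below f -> bounded_below g ->
    (forall y, f y <= g y) -> E f <= E g
}.

(* A situation is a sequence over X, and a path is a map nat -> X whose
   entries are numbered from 0. *)
Definition imprecise_tree (R : realType) (X : finType)
    (Q : seq X -> (X -> \bar R) -> \bar R) : Prop :=
  forall s, upper_expectation (Q s).

Definition supermartingale (R : realType) (X : finType)
    (Q : seq X -> (X -> \bar R) -> \bar R) (M : seq X -> \bar R) : Prop :=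
  bounded_below M /\ forall s, Q s (fun x => M (rcons s x)) <= M s.

Definition path_prefix (X : finType) (w : nat -> X) (n : nat) : seq X :=
  mkseq w n.

Definition cylinder (X : finType) (s : seq X) : set (nat -> X) :=
  [set w | path_prefix w (size s) = s].

Definition test_supermartingale (R : realType) (X : finType)
    (Q : seq X -> (X -> \bar R) -> \bar R) (s : seq X)
    (T : seq X -> \bar R) : Prop :=
  [/\ supermartingale Q T, forall t, 0 <= T t & T s = 1].

Definition strictly_almost_sure (R : realType) (X : finType)
    (Q : seq X -> (X -> \bar R) -> \bar R) (s : seq X)
    (A : set (nat -> X)) : Prop :=
  A `<=` cylinder s /\
  exists T : seq X -> \bar R, test_supermartingale Q s T /\
    forall w, (cylinder s `\` A) w ->
      (fun n : nat => T (path_prefix w n)) @ \oo --> +oo.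

Definition converges_to_real (R : realType) (X : finType)
    (M : seq X -> \bar R) (w : nat -> X) : Prop :=
  exists r : R, (fun n : nat => M (path_prefix w n)) @ \oo --> r%:E.

(* Main.v *)
(** After adding a constant, [1 <= M].  For rational levels [l < u], buy [M] when
    it falls below [l] and sell it when it rises above [u], always reinvesting
    everything: each round multiplies the wealth by at least [u / l], and in
    between the wealth drops at most by the factor [l], because [1 <= M < l] at
    the moment of buying.  So the wealth tends to [+oo] whenever [M] oscillates
    across the band.  The [k]-th strategy receives [2^-(k+1)] and stays idle until
    time [k]; the mixture of all of them is then a finite sum at each time.  Half
    of the capital is held in [M] throughout, to win when [M] tends to [+oo].  The
    total capital is at each step an affine function of the next value of [M] with
    a positive slope, so it is a supermartingale by [E1]-[E3], and setting it to
    [+oo] once [M] has been [+oo] agrees with this affine function. *)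
Require Import Defs.
From mathcomp Require Import all_boot all_order all_algebra.
From mathcomp Require Import all_classical all_reals all_analysis.
From mathcomp Require Import ring zify.

Set Implicit Arguments.
Unset Strict Implicit.
Unset Printing Implicit Defensive.

Import Order.TTheory GRing.Theory Num.Theory.
Import numFieldNormedType.Exports.

Local Open Scope classical_set_scope.
Local Open Scope ring_scope.

(** * Histories of a sequence *)

(* The most recent value comes first. *)
Definition history (T : Type) (a : nat -> T) (n : nat) : seq T :=
  rev (mkseq a n.+1).

Lemma historyS (T : Type) (a : nat -> T) (n : nat) :
  history a n.+1 = a n.+1 :: history a n.
Proof. by rewrite /history mkseqS rev_rcons. Qed.

Lemma size_history (T : Type) (a : nat -> T) (n : nat) :
  size (history a n) = n.+1.
Proof. by rewrite size_rev size_mkseq. Qed.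

Lemma head_history (T : Type) (x0 : T) (a : nat -> T) (n : nat) :
  head x0 (history a n) = a n.
Proof. by case: n => [//|n]; rewrite historyS. Qed.

Lemma last_history (T : Type) (x0 : T) (a : nat -> T) (n : nat) :
  last x0 (history a n) = a 0%N.
Proof. by elim: n x0 => [//|n IHn] x0; rewrite historyS /= IHn. Qed.

Lemma map_history (T U : Type) (f : T -> U) (a : nat -> T) (n : nat) :
  map f (history a n) = history (f \o a) n.
Proof. by rewrite /history map_rev /mkseq -map_comp. Qed.

Lemma all_history (T : Type) (p : pred T) (a : nat -> T) (n : nat) :
  (forall i, (i <= n)%N -> p (a i)) -> all p (history a n).
Proof.
elim: n => [|n IHn] pa; first by rewrite /history /= pa.
by rewrite historyS /= pa //= IHn // => i /leqW; apply: pa.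
Qed.

Lemma history_all (T : Type) (p : pred T) (a : nat -> T) (n : nat) :
  all p (history a n) -> forall i, (i <= n)%N -> p (a i).
Proof.
elim: n => [|n IHn].
  by rewrite /history /= andbT => pa i; rewrite leqn0 => /eqP->.
rewrite historyS /= => /andP[pa /IHn pas] i.
by rewrite leq_eqVlt ltnS => /orP[/eqP->|/pas].
Qed.

Lemma eq_history (T : Type) (a b : nat -> T) (n : nat) :
  (forall i, (i <= n)%N -> a i = b i) -> history a n = history b n.
Proof.
move=> ab; congr rev; apply/eq_in_map => i.
by rewrite mem_iota add0n ltnS => /andP[_]; apply: ab.
Qed.

(** * Trading strategies and their mixture *)

(** Codes of rational pairs index the countably many strategies. A number that encodes no pair gets
    the band [(0, 0)], whose strategy never buys at positive prices. *)
Definition band (R : realType) (k : nat) : R * R :=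
  let q : rat * rat := odflt (0, 0) (unpickle k) in (ratr q.1, ratr q.2).
Arguments band : simpl never.

(* The test [k < size vs] keeps strategy [k] idle before time [k]. *)
Fixpoint holding (R : realType) (k : nat) (vs : seq R) : bool :=
  if vs is v :: vs' then
    (k < size vs)%N &&
    ((v < (band R k).1) || (v <= (band R k).2) && holding k vs')
  else false.

Fixpoint wealth (R : realType) (k : nat) (vs : seq R) : R :=
  if vs is v :: vs' then
    wealth k vs' * (if holding k vs' then v / head 0 vs' else 1)
  else 1.

(* The last term is the capital not yet given to the strategies [k >= size vs]. *)
Definition mixture (R : realType) (vs : seq R) : R :=
  \sum_(k < size vs) 2^-1 ^+ k.+1 * wealth k vs + 2^-1 ^+ size vs.

(** The number of units of the asset held by all strategies together: the slope of the next mixture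
    in the next price. *)
Definition exposure (R : realType) (vs : seq R) : R :=
  \sum_(k < size vs) 2^-1 ^+ k.+1 *
    (if holding k vs then wealth k vs / head 0 vs else 0).

(** Histories are reversed, so [last 0 vs] is the initial price and the first summand is a
    buy-and-hold position. *)
Definition capital (R : realType) (vs : seq R) : R :=
  (head 0 vs / last 0 vs + mixture vs) / 2.

Definition stake (R : realType) (vs : seq R) : R :=
  ((last 0 vs)^-1 + exposure vs) / 2.

Lemma holding_nonempty (R : realType) (k : nat) (vs : seq R) :
  holding k vs -> vs != [::].
Proof. by case: vs. Qed.

Lemma holding_early (R : realType) (k : nat) (vs : seq R) :
  (size vs <= k)%N -> holding k vs = false.
Proof. by case: vs => [//|v vs] /= vsk; rewrite ltnNge vsk. Qed.

Lemma wealth_early (R : realType) (k : nat) (vs : seq R) :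
  (size vs <= k.+1)%N -> wealth k vs = 1.
Proof.
elim: vs => [//|v vs IHvs] /= vsk.
by rewrite holding_early // mulr1 IHvs // ltnW.
Qed.

Lemma wealth_ge0 (R : realType) (k : nat) (vs : seq R) :
  all (>= 0) vs -> 0 <= wealth k vs.
Proof.
elim: vs => [//|v vs IHvs] /= /andP[v0 vs0]; rewrite mulr_ge0 ?IHvs //.
case: ifP => // _; rewrite divr_ge0 //.
by case: vs vs0 {IHvs} => [//|v' vs] /= /andP[].
Qed.

Lemma head_gt0 (R : realType) (vs : seq R) :
  vs != [::] -> all (> 0) vs -> 0 < head 0 vs.
Proof. by case: vs => [//|v vs] _ /= /andP[]. Qed.

Lemma last_gt0 (R : realType) (vs : seq R) :
  vs != [::] -> all (> 0) vs -> 0 < last 0 vs.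
Proof.
case/lastP: vs => [//|vs v] _; rewrite last_rcons all_rcons.
by case/andP.
Qed.

(** With [n = size vs], the undistributed [2^-n] splits into two halves: one goes to strategy [n],
    whose wealth is still 1, the other stays in reserve. Each older strategy gains its number of
    units times the price increment. *)
Lemma mixture_cons (R : realType) (v : R) (vs : seq R) :
  all (> 0) vs ->
  mixture (v :: vs) = mixture vs + exposure vs * (v - head 0 vs).
Proof.
move=> vs0; rewrite /mixture /exposure /= big_ord_recr /=.
rewrite holding_early // mulr1 wealth_early // mulr1 mulr_suml.
have halves n : 2^-1 ^+ n.+1 + 2^-1 ^+ n.+1 = 2^-1 ^+ n :> R.
  by rewrite exprS; field.
rewrite -addrA halves.
rewrite addrAC -big_split /=; congr (_ + _); apply: eq_bigr => k _.
case: ifP => [hk|_]; last by rewrite mulr1 mulr0 mul0r addr0.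
have vsN0 := holding_nonempty hk.
have h0 : head 0 vs != 0 by rewrite gt_eqF ?head_gt0.
by field.
Qed.

Lemma capital_cons (R : realType) (v : R) (vs : seq R) :
  vs != [::] -> all (> 0) vs ->
  capital (v :: vs) = capital vs + stake vs * (v - head 0 vs).
Proof.
move=> vsN0 vs0; rewrite /capital /stake mixture_cons //.
have -> : last 0 (v :: vs) = last 0 vs by case: (vs) vsN0.
have l0 : last 0 vs != 0 by rewrite gt_eqF ?last_gt0.
by rewrite /=; field.
Qed.

Lemma all_gt0_ge0 (R : realType) (vs : seq R) : all (> 0) vs -> all (>= 0) vs.
Proof. by apply: sub_all => x /= /ltW. Qed.

(** The buy-and-hold half makes the slope strictly positive, so that an infinite next price yields
    infinite capital. *)
Lemma stake_gt0 (R : realType) (vs : seq R) :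
  vs != [::] -> all (> 0) vs -> 0 < stake vs.
Proof.
move=> vsN0 vs0; rewrite divr_gt0 // ltr_pwDl ?invr_gt0 ?last_gt0 //.
apply: sumr_ge0 => k _; rewrite mulr_ge0 ?exprn_ge0 ?invr_ge0 //.
case: ifP => // _; rewrite divr_ge0 ?wealth_ge0 ?all_gt0_ge0 //.
by rewrite ltW ?head_gt0.
Qed.

Lemma mixture_ge_wealth (R : realType) (k : nat) (vs : seq R) :
  (k < size vs)%N -> all (> 0) vs ->
  2^-1 ^+ k.+1 * wealth k vs <= mixture vs.
Proof.
move=> ks vs0; rewrite /mixture (bigD1 (Ordinal ks)) //= -addrA lerDl.
rewrite addr_ge0 ?exprn_ge0 ?invr_ge0 // sumr_ge0 // => i _.
by rewrite mulr_ge0 ?exprn_ge0 ?invr_ge0 ?wealth_ge0 ?all_gt0_ge0.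
Qed.

Lemma mixture_ge0 (R : realType) (vs : seq R) : all (> 0) vs -> 0 <= mixture vs.
Proof.
move=> vs0; rewrite addr_ge0 ?exprn_ge0 ?invr_ge0 // sumr_ge0 // => i _.
by rewrite mulr_ge0 ?exprn_ge0 ?invr_ge0 ?wealth_ge0 ?all_gt0_ge0.
Qed.

Lemma capital_ge0 (R : realType) (vs : seq R) : all (> 0) vs -> 0 <= capital vs.
Proof.
move=> vs0; rewrite divr_ge0 // addr_ge0 ?mixture_ge0 //.
case: (eqVneq vs [::]) => [->|vsN0]; first by rewrite /= mul0r.
by rewrite divr_ge0 ?ltW ?head_gt0 ?last_gt0.
Qed.

Lemma capital1 (R : realType) (v : R) : 0 < v -> capital [:: v] = 1.
Proof.
move=> v0; rewrite /capital /mixture /= big_ord1 /= mul1r mulr1 divff ?gt_eqF //.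
by field.
Qed.

(** * Growth of one strategy through upcrossings *)

(* Valuing a held asset at the lower level instead of its current price makes
   the wealth monotone. *)
Definition reserve (R : realType) (k : nat) (vs : seq R) : R :=
  if holding k vs then (band R k).1 * (wealth k vs / head 0 vs)
  else wealth k vs.

(** Buying at [v < l] multiplies the reserve by [l / v]; holding keeps the number of units; selling
    above [u] replaces the unit value [l] by a larger one. *)
Lemma reserve_cons (R : realType) (k : nat) (v : R) (vs : seq R) :
  all (> 0) (v :: vs) -> 0 < (band R k).1 < (band R k).2 ->
  reserve k vs <= reserve k (v :: vs).
Proof.
rewrite /reserve /=; set l := (band R k).1; set u := (band R k).2.
move=> /andP[v0 vs0] /andP[l0 lu].
have w0 : 0 <= wealth k vs by rewrite wealth_ge0 ?all_gt0_ge0.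
case: ifPn => hk; last first.
  rewrite andbF orbF mulr1; case: ifP => // /andP[_ vl].
  by rewrite mulrCA ler_peMr // ler_pdivlMr // mul1r ltW.
have vsN0 := holding_nonempty hk.
have h0 := head_gt0 vsN0 vs0.
have -> : (k < (size vs).+1)%N.
  by apply: contraLR hk; rewrite -leqNgt => /ltnW/holding_early ->.
case: ifPn => /=.
  move=> _; rewrite le_eqVlt; apply/orP; left; apply/eqP.
  by field; rewrite !gt_eqF.
rewrite negb_or andbT -ltNge => /andP[_ uv].
rewrite [l * _]mulrC -mulrA ler_wpM2l // mulrC ler_wpM2r ?invr_ge0 ?ltW //.
exact: lt_trans uv.
Qed.

(** Before the sale each unit counts as [l], afterwards as [v], which exceeds [u]. *)
Lemma reserve_sell (R : realType) (k : nat) (v : R) (vs : seq R) :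
  all (> 0) (v :: vs) -> 0 < (band R k).1 < (band R k).2 ->
  holding k vs -> (band R k).2 < v ->
  (band R k).2 / (band R k).1 * reserve k vs <= reserve k (v :: vs).
Proof.
rewrite /reserve /=; set l := (band R k).1; set u := (band R k).2.
move=> /andP[v0 vs0] /andP[l0 lu] hk uv; rewrite hk.
have w0 : 0 <= wealth k vs by rewrite wealth_ge0 ?all_gt0_ge0.
have vsN0 := holding_nonempty hk.
have h0 := head_gt0 vsN0 vs0.
rewrite [v < l]ltNge (ltW (lt_trans lu uv)) [v <= u]leNgt uv /= andbF mulrA mulfVK ?gt_eqF //.
by rewrite mulrCA ler_wpM2l // ler_wpM2r ?invr_ge0 ?ltW.
Qed.

(** Prices are at least 1, so the number of units held never exceeds the wealth. *)
Lemma reserve_le_wealth (R : realType) (k : nat) (vs : seq R) :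
  all (>= 1) vs -> 1 <= (band R k).1 ->
  reserve k vs <= (band R k).1 * wealth k vs.
Proof.
move=> vs1 l1; have vs0 : all (>= 0) vs.
  by apply: sub_all vs1 => x /=; apply: le_trans.
have w0 := wealth_ge0 k vs0.
rewrite /reserve; case: ifPn => [hk|_]; last by rewrite ler_peMl.
rewrite ler_wpM2l ?(le_trans ler01) //.
case: vs vs1 {vs0 hk} w0 => [|v vs] /=; first by rewrite invr0 mulr0.
by move=> /andP[v1 _] w0; rewrite ler_pdivrMr ?(lt_le_trans ltr01) // ler_peMr.
Qed.

Lemma reserve_cvgy (R : realType) (a : nat -> R) (k : nat) :
  (forall n, 0 < a n) -> 0 < (band R k).1 < (band R k).2 ->
  (forall n, exists2 m, (n <= m)%N & a m < (band R k).1) ->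
  (forall n, exists2 m, (n <= m)%N & (band R k).2 < a m) ->
  (fun n => reserve k (history a n)) @ \oo --> +oo.
Proof.
move=> a0; set l := (band R k).1; set u := (band R k).2 => lu below above.
have h0 n : all (> 0) (history a n) by apply: all_history.
have W_nd : {homo (fun n => reserve k (history a n)) : m n / (m <= n)%N >-> m <= n}.
  apply: homo_leq => [x|y x z|n]; [exact: lexx|exact: le_trans|].
  by rewrite historyS reserve_cons -?historyS.
have [l0 lltu] := andP lu.
have W0 : 0 < reserve k (history a 0).
  rewrite /reserve /history /= !mul1r; case: ifP => // _.
  by rewrite mulr_gt0 ?invr_gt0.
have W_grow n : exists m, u / l * reserve k (history a n) <= reserve k (history a m).
  (* From time [k] on the strategy is awake, so it holds the asset at time [p]. *)
  have [p np pl] := below (maxn n k); have [q pq qu] := above p.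
  have hp : holding k (history a p).
    case: p np pl {pq} => [|p] np pl; rewrite ?historyS /= ?size_history.
      by rewrite pl andbT; lia.
    by rewrite pl andbT; lia.
  have [m [pm hm um]] :
      exists m, [/\ (p <= m)%N, holding k (history a m) & u < a m.+1].
    (* Without a sale the position would persist through time [q] with all prices at most [u]. *)
    apply: contrapT => no.
    have hold i : holding k (history a (p + i)) && (a (p + i)%N <= u).
      elim: i => [|i /andP[hi ai]].
        by rewrite addn0 hp (ltW (lt_trans pl _)).
      have ui : a (p + i).+1 <= u.
        rewrite leNgt; apply/negP => ui; apply: no; exists (p + i)%N.
        by split=> //; lia.
      rewrite addnS ui historyS /= ui hi orbT !andbT size_history; lia.
    by have := hold (q - p)%N; rewrite subnKC // leNgt qu andbF.
  exists m.+1; apply: (@le_trans _ _ (u / l * reserve k (history a m))).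
    rewrite ler_wpM2l ?W_nd //; last by lia.
    by rewrite divr_ge0 ?ltW // (lt_trans l0).
  by rewrite historyS reserve_sell -?historyS.
apply: nondecreasing_dvgn_lt => // Wc.
set L := limn (fun n => reserve k (history a n)).
have WL n : reserve k (history a n) <= L by apply: nondecreasing_cvgn_le.
have L0 : 0 < L by apply: lt_le_trans (WL 0%N).
have ul0 : 0 < u / l by rewrite divr_gt0 // (lt_trans l0).
(* Every reserve is exceeded by the factor [u / l] later on, hence is at most [L / (u / l)]; as
   [L > 0], this is absurd. *)
have : L <= L / (u / l).
  apply: limr_le => //; apply: nearW => n.
  rewrite ler_pdivlMr // mulrC.
  by have [m /le_trans] := W_grow n; apply; apply: WL.
by apply/negP; rewrite -ltNge ltr_pdivrMr // ltr_pMr // ltr_pdivlMr // mul1r.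
Qed.

(** * Convergence or unbounded capital for real sequences *)

Lemma band_surj (R : realType) (p q : rat) :
  exists k, band R k = (ratr p, ratr q).
Proof. by exists (pickle (p, q)); rewrite /band pickleK. Qed.

(** The limit is the lower limit, written as the supremum of the eventual lower bounds. A rational
    [p] above it is undershot infinitely often, so [a] is eventually at most any rational [q > p];
    both are chosen within [e] of the lower limit. *)
Lemma oscillation_cvgr (R : realType) (a : nat -> R) (x0 y0 : R) :
  (forall n, x0 <= a n) ->
  (forall n, exists2 m, (n <= m)%N & a m < y0) ->
  (forall p q : rat, p < q ->
    (forall n, exists2 m, (n <= m)%N & a m < ratr p) ->
    exists n, forall m, (n <= m)%N -> a m <= ratr q) ->
  exists r : R, a @ \oo --> r.
Proof.
move=> ax0 ay0 osc.
pose S := [set x : R | exists n, forall m, (n <= m)%N -> x <= a m].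
have supS : has_sup S.
  split; first by exists x0, 0%N => m _; apply: ax0.
  exists y0 => x [n xa]; have [m nm am] := ay0 n.
  by rewrite ltW // (le_lt_trans (xa m nm)).
exists (sup S); apply/cvgrPdist_le => e e0.
have [x [n1 xa] ex] := sup_adherent e0 supS.
have [p] : exists p : rat, ratr p \in `](sup S), (sup S + e)[.
  by apply: rat_in_itvoo; rewrite ltrDl.
rewrite in_itv /= => /andP[Sp pe].
have [q] : exists q : rat, ratr q \in `](ratr p), (sup S + e)[ by apply: rat_in_itvoo.
rewrite in_itv /= => /andP[pq qe].
have [n2 aq] : exists n, forall m, (n <= m)%N -> a m <= ratr q.
  apply: (osc p) => [|n]; first by move: pq; rewrite ltr_rat.
  apply: contrapT => no; move: Sp; rewrite ltNge => /negP; apply.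
  apply: ub_le_sup; first by case: supS.
  exists n => m nm; rewrite leNgt; apply/negP => am; apply: no.
  by exists m.
near=> n; rewrite ler_distlC; apply/andP; split.
- by rewrite (le_trans (ltW ex)) // xa //; near: n; apply: nbhs_infty_ge.
- by rewrite (le_trans _ (ltW qe)) // aq //; near: n; apply: nbhs_infty_ge.
Unshelve. all: by end_near. Qed.

Lemma capital_cvgy (R : realType) (a : nat -> R) :
  (forall n, 1 <= a n) -> ~ (exists r : R, a @ \oo --> r) ->
  (fun n => capital (history a n)) @ \oo --> +oo.
Proof.
move=> a1 ndiv.
have a0 n : 0 < a n by apply: lt_le_trans (a1 n).
have h0 n : all (> 0) (history a n) by apply: all_history.
have h1 n : all (>= 1) (history a n) by apply: all_history.
apply/cvgryPge => A.
(* If no level is undershot infinitely often, the sequence tends to [+oo] and the buy-and-hold half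
   suffices. *)
have [[y ay]|noy] :=
    pselect (exists y, forall n, exists2 m, (n <= m)%N & a m < y); last first.
  have [n na] : exists n, forall m, (n <= m)%N -> A * 2 * a 0%N <= a m.
    apply: contrapT => no; apply: noy; exists (A * 2 * a 0%N) => n.
    apply: contrapT => no'; apply: no; exists n => m nm; rewrite leNgt.
    by apply/negP => am; apply: no'; exists m.
  near=> m; have nm : (n <= m)%N by near: m; apply: nbhs_infty_ge.
  rewrite /capital head_history last_history ler_pdivlMr //.
  rewrite -[leLHS]addr0 lerD ?mixture_ge0 //.
  by rewrite ler_pdivlMr ?na.
have [p [q [pq below above]]] : exists p q : rat, [/\ p < q,
    (forall n, exists2 m, (n <= m)%N & a m < ratr p) &
    (forall n, exists2 m, (n <= m)%N & ratr q < a m)].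
  apply: contrapT => no; apply: ndiv.
  apply: (oscillation_cvgr a1 ay) => p q pq below.
  apply: contrapT => no'; apply: no; exists p, q; split=> // n.
  apply: contrapT => no''; apply: no'; exists n => m nm; rewrite leNgt.
  by apply/negP => am; apply: no''; exists m.
have [k bk] := band_surj R p q.
have p1 : 1 <= ratr p :> R.
  by have [m _ mp] := below 0%N; rewrite ltW // (le_lt_trans (a1 m)).
have Wy : (fun n => reserve k (history a n)) @ \oo --> +oo.
  by apply: reserve_cvgy => //; rewrite bk //= ltr_rat pq (lt_le_trans _ p1).
(* The factor [2 ^+ k.+2] undoes the weight of strategy [k] and the halving in [capital]; [ratr p]
   is the loss from reserve to wealth. *)
have /cvgryPge/(_ (2 ^+ k.+2 * ratr p * A)) WA := Wy.
near=> n.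
have kn : (k < size (history a n))%N.
  by rewrite size_history ltnS; near: n; apply: nbhs_infty_ge.
have AW : 2 ^+ k.+2 * ratr p * A <= reserve k (history a n) by near: n.
have Ww := @reserve_le_wealth _ k (history a n) (h1 n).
rewrite bk /= in Ww; have {}AW := le_trans AW (Ww p1).
have mw := mixture_ge_wealth kn (h0 n).
have hl : 0 <= head 0 (history a n) / last 0 (history a n).
  by rewrite head_history last_history divr_ge0 ?ltW.
rewrite /capital ler_pdivlMr // -[leLHS]add0r lerD // (le_trans _ mw) //.
rewrite exprVn ler_pdivlMl ?exprn_gt0 //.
rewrite -(@ler_pM2l _ (ratr p)) ?(lt_le_trans _ p1) // (le_trans _ AW) //.
by rewrite (exprS _ k.+1) le_eqVlt; apply/orP; left; apply/eqP; ring.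
Unshelve. all: by end_near. Qed.

(** * Upper expectations under affine maps *)

Local Open Scope ereal_scope.

(** Subadditivity is stated for the dual addition, which agrees with the default one when a summand
    is finite. *)
Lemma upper_shift (R : realType) (Y : Type) (E : (Y -> \bar R) -> \bar R)
    (f : Y -> \bar R) (c : R) :
  upper_expectation E -> bounded_below f ->
  E (fun y => f y + c%:E) <= E f + c%:E.
Proof.
move=> hE bf; have := upper_subadd hE bf (ex_intro _ c (fun=> lexx c%:E)).
by rewrite upper_cst // DualAddTheoryNumDomain.dual_addeE_def ?fin_num_adde_defl //.
Qed.

Lemma upper_affine (R : realType) (Y : Type) (E : (Y -> \bar R) -> \bar R)
    (f : Y -> \bar R) (b c : R) :
  upper_expectation E -> (forall y, 0 <= f y) -> (0 < b)%R ->
  E (fun y => b%:E * f y + c%:E) <= b%:E * E f + c%:E.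
Proof.
move=> hE f0 b0; rewrite -(upper_homo hE) ?lte_fin //.
apply: upper_shift => //; exists 0%R => y.
by apply: mule_ge0 => //; rewrite lee_fin ltW.
Qed.

Lemma supermartingale_shift (R : realType) (X : finType)
    (Q : seq X -> (X -> \bar R) -> \bar R) (M : seq X -> \bar R) (c : R) :
  imprecise_tree Q -> supermartingale Q M ->
  supermartingale Q (fun t => M t + c%:E).
Proof.
move=> treeQ [[m mM] QM]; split.
  by exists (m + c)%R => t; rewrite EFinD leeD2r.
move=> t; apply: (le_trans (upper_shift _ (treeQ t) _)).
  by exists m.
by rewrite leeD2r.
Qed.

(** * The capital process on the tree *)

(** [history] at [n] lists [n + 1] values, so for [t] extending [s] both [M s] and [M t] occur. *)
Definition path_history (R : realType) (X : finType) (M : seq X -> \bar R)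
    (s t : seq X) : seq (\bar R) :=
  history (fun i => M (take (size s + i) t)) (size t - size s).

Lemma path_history_rcons (R : realType) (X : finType) (M : seq X -> \bar R)
    (s t : seq X) (x : X) :
  (size s <= size t)%N ->
  path_history M s (rcons t x) = M (rcons t x) :: path_history M s t.
Proof.
move=> st; rewrite /path_history size_rcons subSn // historyS addnS subnKC //.
rewrite take_oversize ?size_rcons //; congr (_ :: _); apply: eq_history => i ist.
by rewrite -cats1 takel_cat // -leq_subRL.
Qed.

Definition doob_capital (R : realType) (X : finType) (M : seq X -> \bar R)
    (s t : seq X) : \bar R :=
  if prefix s t then
    let h := path_history M s t in
    if all (fun v => v \is a fin_num) h then (capital (map fine h))%:E
    else +oo
  else 1.

Lemma all_fine_ge1 (R : realType) (h : seq (\bar R)) :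
  all (fun v => v \is a fin_num) h -> all (fun v => 1 <= v) h ->
  all (>= 1)%R (map fine h).
Proof.
elim: h => [//|v h IHh] /= /andP[vf hf] /andP[v1 h1]; rewrite IHh // andbT.
by rewrite -lee_fin fineK.
Qed.

Lemma doob_capital_test (R : realType) (X : finType)
    (Q : seq X -> (X -> \bar R) -> \bar R) (M : seq X -> \bar R) (s : seq X) :
  imprecise_tree Q -> supermartingale Q M -> (forall t, 1 <= M t) ->
  M s \is a fin_num -> test_supermartingale Q s (doob_capital M s).
Proof.
move=> treeQ [_ QM] M1 Ms.
have gt0 t : all (fun v => v \is a fin_num) (path_history M s t) ->
    all (> 0)%R (map fine (path_history M s t)).
  move=> hf; apply: (@sub_all _ (>= 1)%R) => [x /= |].
    exact: lt_le_trans ltr01.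
  by apply: all_fine_ge1 => //; apply: all_history.
have T0 t : 0 <= doob_capital M s t.
  rewrite /doob_capital; case: ifP => // _; case: ifP => // hf.
  by rewrite lee_fin capital_ge0 ?gt0.
have Ts : doob_capital M s s = 1.
  rewrite /doob_capital prefix_refl /path_history subnn /history /= addn0.
  rewrite take_size Ms /= capital1 // -lte_fin fineK //.
  exact: lt_le_trans (M1 s).
split=> //; split; first by exists 0%R.
move=> t; case: (boolP (prefix s t)) => st; last first.
  (* A child of [t] that extends [s] can only be [s] itself, where the capital is 1. *)
  have -> : (fun x => doob_capital M s (rcons t x)) = (fun=> 1%:E).
    apply/funext => x; case: (eqVneq s (rcons t x)) => [<- //|sx].
    rewrite /doob_capital ifF //; apply: contraNF st.
    move=> /prefixP[u]; case/lastP: u => [|u y].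
      by rewrite cats0 => eq; rewrite eq eqxx in sx.
    by rewrite -rcons_cat => /rcons_inj[-> _]; rewrite prefix_prefix.
  by rewrite upper_cst // /doob_capital (negbTE st).
have leq_st : (size s <= size t)%N by apply: size_prefix.
set h := path_history M s t.
case: (boolP (all (fun v => v \is a fin_num) h)) => hf; last first.
  by rewrite {2}/doob_capital st (negbTE hf) leey.
set g := map fine h; have g0 : all (> 0)%R g by apply: gt0.
have gN0 : g != [::] by rewrite -size_eq0 size_map size_history.
have headg : head 0%R g = fine (M t).
  by rewrite /g map_history head_history /= subnKC // take_size.
have Mt : M t \is a fin_num.
  by have := history_all hf (leqnn _); rewrite subnKC // take_size.
have -> : (fun x => doob_capital M s (rcons t x)) =
    (fun x => (stake g)%:E * M (rcons t x) +
              (capital g - stake g * fine (M t))%:E).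
  apply/funext => x; rewrite /doob_capital.
  rewrite -cats1 prefix_catl // cats1 path_history_rcons //= -/h hf andbT.
  have := M1 (rcons t x); case: (M (rcons t x)) => [v _| |] //=.
    rewrite -/g capital_cons // headg -EFinM -EFinD; congr (_%:E).
    by rewrite mulrBr addrCA.
  by rewrite gt0_muley ?lte_fin ?stake_gt0.
apply: (le_trans (upper_affine _ (treeQ t) _ (stake_gt0 gN0 g0))).
  by move=> x; apply: le_trans (M1 _).
rewrite [leRHS]/doob_capital st -/h hf -/g.
(* The increasing affine map is compared at the upper expectation of the next value and at [M t],
   where it equals [capital g]. *)
apply: (@le_trans _ _ ((stake g)%:E * M t + (capital g - stake g * fine (M t))%:E)).
  by rewrite leeD2r // lee_wpmul2l // lee_fin ltW // stake_gt0.
by rewrite -{1}(fineK Mt) -EFinM -EFinD lee_fin addrCA subrr addr0.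
Qed.

(** * Divergence of the capital along paths *)

Lemma take_path_prefix (X : finType) (w : nat -> X) (i n : nat) :
  (i <= n)%N -> take i (path_prefix w n) = path_prefix w i.
Proof.
by move=> le_in; rewrite /path_prefix /mkseq -map_take take_iota (minn_idPl le_in).
Qed.

Lemma path_history_path (R : realType) (X : finType) (M : seq X -> \bar R)
    (s : seq X) (w : nat -> X) (n : nat) :
  path_history M s (path_prefix w (size s + n)) =
  history (fun i => M (path_prefix w (size s + i))) n.
Proof.
rewrite /path_history size_mkseq addKn; apply: eq_history => i le_in.
by rewrite take_path_prefix // leq_add2l.
Qed.

Lemma doob_capital_cvgy (R : realType) (X : finType) (M : seq X -> \bar R)
    (s : seq X) (w : nat -> X) :
  (forall t, 1 <= M t) -> cylinder s w -> ~ converges_to_real M w ->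
  (fun n => doob_capital M s (path_prefix w n)) @ \oo --> +oo.
Proof.
move=> M1 sw ndiv; rewrite -(cvg_shiftn (size s)).
pose a i := M (path_prefix w (size s + i)).
have TE n : doob_capital M s (path_prefix w (n + size s)) =
    if all (fun v => v \is a fin_num) (history a n) then
      (capital (history (fine \o a) n))%:E else +oo.
  rewrite /doob_capital prefixE take_path_prefix ?leq_addl // sw eqxx addnC.
  by rewrite path_history_path map_history.
rewrite [X in X @ _ --> _](funext TE).
have [fin|] := pselect (forall i, a i \is a fin_num).
  have -> : (fun n => if all (fun v => v \is a fin_num) (history a n) then
      (capital (history (fine \o a) n))%:E else +oo) =
    (fun n => (capital (history (fine \o a) n))%:E).
    by apply/funext => n; rewrite all_history.
  apply/cvgeryP; apply: capital_cvgy => [n|[r ar]].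
    by rewrite -lee_fin /= fineK // M1.
  apply: ndiv; exists r; rewrite -(cvg_shiftn (size s)).
  have -> : (fun n => M (path_prefix w (n + size s))) = a.
    by apply/funext => n; rewrite addnC.
  exact: (cvg_EFin (nearW _ fin) ar).
(* One infinite value of [M] keeps the capital at [+oo] from then on. *)
move=> /existsNP[i ai]; apply/cvgeyPge => A; near=> n.
have le_in : (i <= n)%N by near: n; apply: nbhs_infty_ge.
case: ifP => [fin|_]; last by rewrite leey.
by case: ai; apply: history_all fin i le_in.
Unshelve. all: by end_near. Qed.

(** * Strictly almost sure convergence *)

Lemma strictly_almost_sure_sub (R : realType) (X : finType)
    (Q : seq X -> (X -> \bar R) -> \bar R) (s : seq X)
    (A B : set (nat -> X)) :
  A `<=` B -> B `<=` cylinder s ->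
  strictly_almost_sure Q s A -> strictly_almost_sure Q s B.
Proof.
move=> AB Bs [_ [T [testT Ty]]]; split=> //; exists T; split=> // w [sw nBw].
by apply: Ty; split=> // /AB.
Qed.

Theorem theorem20 (R : realType) (X : finType) (X_neq0 : (0 < #|X|)%N)
    (Q : seq X -> (X -> \bar R) -> \bar R) (treeQ : imprecise_tree Q)
    (M : seq X -> \bar R) (superM : supermartingale Q M)
    (s : seq X) (Ms_real : M s \is a fin_num) :
  strictly_almost_sure Q s
    [set w | cylinder s w /\ converges_to_real M w].
Proof.
have [[m mM] _] := superM; pose c : R := (1 - m)%R.
pose N t := M t + c%:E.
have N1 t : 1 <= N t by rewrite -leeBlDr // -EFinB opprB addrC subrK.
(* Undoing the shift preserves real limits, so it suffices to treat [N], which is at least 1 by the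
   choice of [c]. *)
apply: (@strictly_almost_sure_sub _ _ _ _
    [set w | cylinder s w /\ converges_to_real N w]).
- move=> w [sw [r Nr]]; split=> //; exists (r - c)%R.
  have -> : (fun n => M (path_prefix w n)) =
      (fun n => N (path_prefix w n) + (- c)%:E).
    by apply/funext => n; rewrite /N EFinN addeK.
  by rewrite EFinD; apply: cvgeD => //; apply: cvg_cst.
- by move=> w [].
split=> [w []//|]; exists (doob_capital N s); split.
  apply: doob_capital_test => //; first exact: supermartingale_shift.
  by rewrite fin_numD Ms_real.
by move=> w [sw ndiv]; apply: doob_capital_cvgy => // ?; apply: ndiv.
Qed.
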